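(* There is a satisfiable HyperLTL sentence that is not satisfied by any $\omega$-context-free set of traces.
   Context: Fix a finite set $AP$ of atomic propositions. A trace over $AP$ is a map $t:\mathbb{N}\to 2^{AP}$, i.e., an infinite word over the alphabet $2^{AP}$; a set of traces is $\omega$-context-free if it is an $\omega$-context-free language over $2^{AP}$ (in the sense of Cohen and Gold, i.e., accepted by a Büchi pushdown automaton). HyperLTL formulas are given by the grammar $\varphi ::= \exists \pi.\ \varphi \mid \forall \pi.\ \varphi \mid \psi$ and $\psi ::= a_\pi \mid \neg\psi \mid \psi\vee\psi \mid \mathbf{X}\psi \mid \psi\,\mathbf{U}\,\psi$, where $a\in AP$ and $\pi$ ranges over a countable set of trace variables. For a set $T$ of traces and a trace assignment $\Pi$ (a partial map from trace variables to traces), with $\Pi[j]$ denoting the assignment mapping each $\pi$ in the domain of $\Pi$ to the suffix $\Pi(\pi)(j)\Pi(\pi)(j+1)\cdots$: $(T,\Pi)\models a_\pi$ iff $a\in\Pi(\pi)(0)$; negation and disjunction are as usual; $(T,\Pi)\models\mathbf{X}\psi$ iff $(T,\Pi[1])\models\psi$; $(T,\Pi)\models\psi_1\mathbf{U}\psi_2$ iff there is $j\ge 0$ with $(T,\Pi[j])\models\psi_2$ and $(T,\Pi[j'])\models\psi_1$ for all $0\le j'<j$; $(T,\Pi)\models\exists\pi.\varphi$ iff there is $t\in T$ with $(T,\Pi[\pi\mapsto t])\models\varphi$; $(T,\Pi)\models\forall\pi.\varphi$ iff this holds for all $t\in T$. A sentence is a formula without free trace variables; $T$ satisfies (is a model of)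 a sentence $\varphi$ if $(T,\Pi_\emptyset)\models\varphi$ for the empty assignment $\Pi_\emptyset$. A sentence is satisfiable if it has a model. *)

(* Defs.v *)
From mathcomp Require Import all_boot.

Set Implicit Arguments.
Unset Strict Implicit.
Unset Printing Implicit Defensive.

Definition trace (AP : finType) : Type := nat -> {set AP}.

Definition suffix_trace (AP : finType) (j : nat) (t : trace AP) : trace AP :=
  fun i => t (j + i).

Inductive body (AP : finType) : Type :=
| Atom of AP & nat
| Neg of body AP
| Or of body AP & body AP
| Next of body AP
| Until of body AP & body AP.

Inductive hyperltl (AP : finType) : Type :=
| Exists of nat & hyperltl AP
| Forall of nat & hyperltl AP
| Body of body AP.

Definition assignment (AP : finType) : Type := nat -> option (trace AP).

Definition empty_assignment (AP : finType) : assignment AP := fun=> None.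

Definition update (AP : finType) (Pi : assignment AP) (x : nat) (t : trace AP) :
  assignment AP := fun y => if y == x then Some t else Pi y.

Definition shift (AP : finType) (j : nat) (Pi : assignment AP) : assignment AP :=
  fun x => omap (suffix_trace j) (Pi x).

(* An atom whose variable is unassigned is false; this never happens when a
   sentence is evaluated from the empty assignment. *)
Fixpoint sat_body (AP : finType) (Pi : assignment AP) (psi : body AP) : Prop :=
  match psi with
  | Atom a x => if Pi x is Some t then a \in t 0 else False
  | Neg psi1 => ~ sat_body Pi psi1
  | Or psi1 psi2 => sat_body Pi psi1 \/ sat_body Pi psi2
  | Next psi1 => sat_body (shift 1 Pi) psi1
  | Until psi1 psi2 =>
      exists j, sat_body (shift j Pi) psi2 /\
        forall j', j' < j -> sat_body (shift j' Pi) psi1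
  end.

Fixpoint sat (AP : finType) (T : trace AP -> Prop) (Pi : assignment AP)
    (phi : hyperltl AP) : Prop :=
  match phi with
  | Exists x phi1 => exists t, T t /\ sat T (update Pi x t) phi1
  | Forall x phi1 => forall t, T t -> sat T (update Pi x t) phi1
  | Body psi => sat_body Pi psi
  end.

Fixpoint body_vars (AP : finType) (psi : body AP) : seq nat :=
  match psi with
  | Atom _ x => [:: x]
  | Neg psi1 | Next psi1 => body_vars psi1
  | Or psi1 psi2 | Until psi1 psi2 => body_vars psi1 ++ body_vars psi2
  end.

Fixpoint free_vars (AP : finType) (phi : hyperltl AP) : seq nat :=
  match phi with
  | Exists x phi1 | Forall x phi1 => [seq y <- free_vars phi1 | y != x]
  | Body psi => body_vars psi
  end.

Definition sentence (AP : finType) (phi : hyperltl AP) : Prop :=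
  free_vars phi = [::].

Definition satisfies (AP : finType) (T : trace AP -> Prop) (phi : hyperltl AP) :
  Prop := sat T (@empty_assignment AP) phi.

Definition satisfiable (AP : finType) (phi : hyperltl AP) : Prop :=
  exists T : trace AP -> Prop, satisfies T phi.

(* Labels in [option A]: [None] is an epsilon move. The list returned by
   [pda_delta] is the finite set of available moves. *)
Record buchi_pda (A : finType) : Type := BuchiPDA {
  pda_state : finType;
  pda_stack : finType;
  pda_delta : pda_state -> option A -> pda_stack ->
              seq (pda_state * seq pda_stack);
  pda_init : pda_state;
  pda_bottom : pda_stack;
  pda_final : {set pda_state} }.

Definition config (A : finType) (M : buchi_pda A) : Type :=
  (pda_state M * seq (pda_stack M))%type.

(* The head of the list is the top of the stack; no move is possible on the
   empty stack. *)
Definition pda_step (A : finType) (M : buchi_pda A) (b : option A)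
    (c c' : config M) : Prop :=
  if c.2 is Z :: gamma then
    exists beta, (c'.1, beta) \in pda_delta c.1 b Z /\ c'.2 = beta ++ gamma
  else False.

(* The infinite concatenation of the labels [b], with the epsilons erased, is
   the infinite word [w]. *)
Definition spells (A : finType) (b : nat -> option A) (w : nat -> A) : Prop :=
  (forall n, let u := pmap id (mkseq b n) in u = mkseq w (size u)) /\
  (forall k, exists n, k <= size (pmap id (mkseq b n))).

Definition pda_run (A : finType) (M : buchi_pda A) (w : nat -> A)
    (r : nat -> config M) : Prop :=
  r 0 = (pda_init M, [:: pda_bottom M]) /\
  exists b : nat -> option A,
    (forall n, pda_step (b n) (r n) (r n.+1)) /\ spells b w.

Definition pda_accepts (A : finType) (M : buchi_pda A) (w : nat -> A) : Prop :=
  exists r : nat -> config M,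
    pda_run w r /\ forall n, exists m, n <= m /\ (r m).1 \in pda_final M.

Definition omega_context_free (AP : finType) (T : trace AP -> Prop) : Prop :=
  exists M : buchi_pda {set AP}, forall t, T t <-> pda_accepts M t.

(* Main.v *)
(** Part of a run of a Büchi pushdown automaton that starts and ends at the same
    control state and top symbol, and that never pops below its starting height,
    can be repeated forever.  Every accepting run has such a part that visits a
    final state and reads a letter, so a nonempty omega-context-free language
    contains an ultimately periodic word.

    The sentence forces all traces of a model to have the same [true]-component
    [s], and forces the model to contain, for every [p > 0], a trace whose
    [false]-component is [s] shifted by [p].  As the two components of every
    trace differ infinitely often, [s] is not ultimately periodic. *)
Require Import Defs.
From mathcomp Require Import all_boot.
From Stdlib Require Import Classical.

Set Implicit Arguments.
Unset Strict Implicit.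
Unset Printing Implicit Defensive.

(** * Infinite sequences and finite colourings *)

Lemma ex_later_min (f : nat -> nat) (n : nat) :
  exists2 i, n <= i & forall j, i <= j -> f i <= f j.
Proof.
(* Descent on a bound [h] for [f n]: either [n] already works, or some later value is smaller and
   takes its place. *)
move: {2}(f n) (leqnn (f n)) => h; elim: h n => [|h IHh] n le_fn_h.
  by exists n => // j _; apply: leq_trans le_fn_h _.
case: (classic (exists2 m, n <= m & f m < f n)) => [[m le_nm lt_fm] | noless].
  have [|i le_mi min_i] := IHh m; first by rewrite -ltnS (leq_trans lt_fm).
  by exists i => //; apply: leq_trans le_mi.
exists n => // j le_nj; rewrite leqNgt; apply/negP => lt_fj.
by apply: noless; exists j.
Qed.

Lemma infinite_pigeonhole (C : finType) (P : C -> nat -> Prop) :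
  (forall n, exists2 i, n <= i & exists c, P c i) ->
  exists c, forall n, exists2 i, n <= i & P c i.
Proof.
move=> infP; apply: NNPP => noc.
have bound c : exists N, forall i, N <= i -> ~ P c i.
  apply: NNPP => nobound; apply: noc; exists c => n.
  apply: NNPP => noi; apply: nobound; exists n => i le_ni Pci.
  by apply: noi; exists i.
have [N boundN] := fin_all_exists bound.
have [i le_Ni [c Pci]] := infP (\max_c N c).
by apply: (boundN c i) Pci; apply: leq_trans le_Ni; apply: leq_bigmax.
Qed.

(** * Prefixes and ultimately periodic sequences *)

Lemma mkseqD (T : Type) (f : nat -> T) (m n : nat) :
  mkseq f (m + n) = mkseq f m ++ mkseq (fun i => f (m + i)) n.
Proof.
by rewrite /mkseq iotaD map_cat add0n -{2}[m]addn0 iotaDl -map_comp.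
Qed.

Lemma prefix_mkseq (T : Type) (f : nat -> T) (s1 s2 : seq T) (n : nat) :
  s1 ++ s2 = mkseq f n -> s1 = mkseq f (size s1).
Proof.
move=> eq_s; have le_sn : size s1 <= n.
  by rewrite -(size_mkseq f n) -eq_s size_cat leq_addr.
rewrite -[LHS](take_size_cat s2 (erefl (size s1))) eq_s -{1}(subnKC le_sn) mkseqD.
by rewrite take_size_cat ?size_mkseq.
Qed.

Definition lasso (T : Type) (i d : nat) (f : nat -> T) (n : nat) : T :=
  if n < i then f n else f (i + (n - i) %% d).

Lemma lasso_prefix (T : Type) (i d n : nat) (f : nat -> T) :
  n < i -> lasso i d f n = f n.
Proof. by rewrite /lasso => ->. Qed.

Lemma lasso_loop (T : Type) (i d k e : nat) (f : nat -> T) :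
  e < d -> lasso i d f (i + (k * d + e)) = f (i + e).
Proof.
by move=> lt_ed; rewrite /lasso ltnNge leq_addr /= addKn modnMDl modn_small.
Qed.

Lemma lasso_periodic (T : Type) (i d n : nat) (f : nat -> T) :
  i <= n -> lasso i d f (n + d) = lasso i d f n.
Proof.
move=> le_in; rewrite /lasso !ltnNge le_in (leq_trans le_in (leq_addr _ _)) /=.
by rewrite -addnBAC // modnDr.
Qed.

Lemma mkseq_lasso (T : Type) (i d k : nat) (f : nat -> T) :
  mkseq (lasso i d f) (i + k * d) =
  mkseq f i ++ flatten (nseq k (mkseq (fun e => f (i + e)) d)).
Proof.
elim: k => [|k IHk].
  rewrite mul0n addn0 cats0; apply/eq_in_map => n.
  by rewrite mem_iota => /andP[_ /lasso_prefix].
rewrite mulSnr addnA mkseqD IHk -catA; congr (_ ++ _).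
rewrite -addn1 nseqD flatten_cat /= cats0; congr (_ ++ _).
apply/eq_in_map => e; rewrite mem_iota => /andP[_ lt_ed].
by rewrite -addnA lasso_loop.
Qed.

(** Each turn of the label loop spells the same [P] letters, so [k] turns spell exactly the first
    [N + k * P] letters of the lasso word. Every other label prefix lies inside such a one, and
    [0 < P] makes the spelled word infinite. *)
Lemma spells_lasso (A : finType) (b : nat -> option A) (w : nat -> A)
    (i d : nat) (N := size (pmap id (mkseq b i)))
    (P := size (pmap id (mkseq (fun e => b (i + e)) d))) :
  spells b w -> 0 < P -> spells (lasso i d b) (lasso N P w).
Proof.
move=> [spell _] P_gt0; have d_gt0 : 0 < d by move: P_gt0; rewrite /P; case: (d).
have loop_spells k : pmap id (mkseq (lasso i d b) (i + k * d)) =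
                     mkseq (lasso N P w) (N + k * P).
  rewrite mkseq_lasso mkseq_lasso pmap_cat.
  congr (_ ++ _); first exact: spell.
  have -> : mkseq (fun e => w (N + e)) P =
            pmap id (mkseq (fun e => b (i + e)) d).
    have : pmap id (mkseq b (i + d)) = mkseq w _ := spell _.
    rewrite mkseqD pmap_cat size_cat mkseqD => /(congr1 (drop N)).
    by rewrite !drop_size_cat ?size_mkseq.
  by elim: k => //= k IHk; rewrite pmap_cat IHk.
split=> [n | k] /=.
  have le_n : n <= i + n * d by rewrite (leq_trans (leq_pmulr n d_gt0)) ?leq_addl.
  have := loop_spells n; rewrite -{1}(subnKC le_n) mkseqD pmap_cat.
  exact: prefix_mkseq.
exists (i + k * d); rewrite loop_spells size_mkseq.
by rewrite (leq_trans (leq_pmulr k P_gt0)) ?leq_addl.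
Qed.

(** * Pumping an accepting run *)

Lemma pda_step_rest (A : finType) (M : buchi_pda A) (a : option A)
    (q : pda_state M) (s rest : seq (pda_stack M)) (c : config M) :
  0 < size s -> pda_step a (q, s ++ rest) c ->
  exists2 s', c.2 = s' ++ rest &
    forall rest', pda_step a (q, s ++ rest') (c.1, s' ++ rest').
Proof.
case: s => // Z s _ [beta [/= move_beta ->]].
by exists (beta ++ s); rewrite ?catA // => rest'; exists beta; rewrite catA.
Qed.

(* While the stack stays strictly higher than [rest], the part of the stack above
   [rest] evolves independently of [rest]. *)
Lemma pda_steps_above (A : finType) (M : buchi_pda A) (b : nat -> option A)
    (r : nat -> config M) (rest : seq (pda_stack M))
    (top := fun e => take (size (r e).2 - size rest) (r e).2) (s0 : seq (pda_stack M)) :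
  (forall n, pda_step (b n) (r n) (r n.+1)) ->
  (r 0).2 = s0 ++ rest -> (forall e, size rest < size (r e).2) ->
  top 0 = s0 /\
  forall e rest', pda_step (b e) ((r e).1, top e ++ rest')
                                 ((r e.+1).1, top e.+1 ++ rest').
Proof.
move=> step r0 high.
have topE e s : (r e).2 = s ++ rest -> top e = s.
  by move=> rE; rewrite /top rE size_cat addnK take_size_cat.
have next e : (r e).2 = top e ++ rest ->
    (r e.+1).2 = top e.+1 ++ rest /\
    forall rest', pda_step (b e) ((r e).1, top e ++ rest')
                                 ((r e.+1).1, top e.+1 ++ rest').
  move=> rE; have := step e; rewrite (surjective_pairing (r e)) rE.
  have top_gt0 : 0 < size (top e).
    by have := high e; rewrite rE size_cat -{1}[size rest]add0n ltn_add2r.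
  case/(pda_step_rest top_gt0) => s' rE' steps.
  by rewrite (topE _ _ rE').
have above e : (r e).2 = top e ++ rest.
  by elim: e => [|e IHe]; [rewrite (topE _ _ r0) | case: (next e IHe)].
by split=> [|e]; [apply: topE | have [] := next e (above e)].
Qed.

(** Infinitely often the stack height is minimal among all later heights. Two such positions share
    state and top symbol by pigeonhole, and the second can be taken late enough for a final state
    and a letter to occur in between. *)
Lemma accepting_loop (A : finType) (M : buchi_pda A) (r : nat -> config M)
    (b : nat -> option A) (w : nat -> A) :
  (forall n, pda_step (b n) (r n) (r n.+1)) -> spells b w ->
  (forall n, exists m, n <= m /\ (r m).1 \in pda_final M) ->
  exists (i d : nat) (q : pda_state M) (Z : pda_stack M)
    (rest rest' : seq (pda_stack M)),
    [/\ r i = (q, Z :: rest), r (i + d) = (q, Z :: rest'),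
        forall j, i <= j -> size rest < size (r j).2,
        0 < size (pmap id (mkseq (fun e => b (i + e)) d)) &
        exists2 e, e < d & (r (i + e)).1 \in pda_final M].
Proof.
move=> step [_ inf_w] inf_final.
pose P (c : pda_state M * pda_stack M) i :=
  exists2 rest, r i = (c.1, c.2 :: rest) &
                forall j, i <= j -> size rest < size (r j).2.
have [n|[q Z] infP] := @infinite_pigeonhole _ P.
  have [i le_ni min_i] := ex_later_min (fun i => size (r i).2) n.
  exists i => //; have := step i; case rE: (r i) min_i => [q [|Z rest]] // min_i _.
  by exists (q, Z); exists rest.
have [i _ [rest /= rE high]] := infP 0.
have [m [le_im final_m]] := inf_final i.
have [n lt_in] := inf_w i.+1.
have [j le_j [rest' /= rE' _]] := infP (maxn m.+1 n).
move: le_j; rewrite geq_max => /andP[lt_mj le_nj].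
have le_ij : i <= j := leq_trans le_im (ltnW lt_mj).
exists i, (j - i), q, Z, rest, rest'; rewrite subnKC //; split=> //.
  (* More than [i] letters are read before [j], while the first [i] labels contribute at most [i];
     so the loop reads a letter. *)
  have lt_ij : i < size (pmap id (mkseq b j)).
    rewrite -(subnKC le_nj) mkseqD pmap_cat size_cat.
    exact: leq_trans lt_in (leq_addr _ _).
  move: lt_ij; rewrite -{1}(subnKC le_ij) mkseqD pmap_cat size_cat lt0n.
  apply: contraTneq => ->; rewrite addn0 -leqNgt size_pmap.
  by rewrite (leq_trans (count_size _ _)) ?size_mkseq.
by exists (m - i); rewrite ?ltn_sub2r ?subnKC // (leq_ltn_trans le_im).
Qed.

Theorem pda_accepts_periodic (A : finType) (M : buchi_pda A) (w : nat -> A) :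
  pda_accepts M w ->
  exists (w' : nat -> A) (N P : nat),
    [/\ pda_accepts M w', 0 < P & forall m, N <= m -> w' (m + P) = w' m].
Proof.
move=> [r [[r0 [b [step spell]]] inf_final]].
have [i [d [q [Z [rest [rest' [ri rid high P_gt0 [f lt_fd final_f]]]]]]]] :=
  accepting_loop step spell inf_final.
have d_gt0 : 0 < d := leq_ltn_trans (leq0n f) lt_fd.
exists (lasso (size (pmap id (mkseq b i)))
              (size (pmap id (mkseq (fun e => b (i + e)) d))) w).
exists (size (pmap id (mkseq b i))).
exists (size (pmap id (mkseq (fun e => b (i + e)) d))).
split=> // [|m]; last exact: lasso_periodic.
pose top e := take (size (r (i + e)).2 - size rest) (r (i + e)).2.
have [||e|top0 steps] := @pda_steps_above _ M (fun e => b (i + e))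
  (fun e => r (i + e)) rest [:: Z].
- by move=> n; rewrite addnS; apply: step.
- by rewrite addn0 ri.
- by apply: high; rewrite leq_addr.
rewrite -/(top 0) in top0.
have {}steps e s : pda_step (b (i + e)) ((r (i + e)).1, top e ++ s)
                            ((r (i + e.+1)).1, top e.+1 ++ s) := steps e s.
(* One turn of the loop pushes [gamma] below the top symbol. *)
have [gamma topd] : exists gamma, top d = Z :: gamma.
  have := high _ (leq_addr d i); rewrite /top rid /= => lt_rest.
  by rewrite subSn //=; eexists.
(* After [n] steps, [n %/ d] turns are complete, and each has left one copy of [gamma] above
   [rest]. *)
pose loop n : config M :=
  ((r (i + n %% d)).1,
   top (n %% d) ++ flatten (nseq (n %/ d) gamma) ++ rest).
exists (fun n => if n < i then r n else loop (n - i)); split; last first.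
  (* The visit to the final state after [n] complete turns. *)
  move=> n; exists (i + (n * d + f)); split.
    rewrite addnCA (leq_trans (leq_pmulr n d_gt0)) ?leq_addr //.
  by rewrite ltnNge leq_addr addKn /= modnMDl modn_small.
split.
  (* If [i = 0], the run starts inside the loop. *)
  case: (posnP i) => [i0|_ //]; rewrite -r0 i0 /loop mod0n div0n addn0 top0.
  by rewrite ri /= -ri i0.
exists (lasso i d b); split; last exact: spells_lasso.
(* The step lies in the prefix, lies in the loop, or enters the loop. *)
move=> n; rewrite /lasso; case: (ltngtP n.+1 i) => [lt_ni | lt_in | eq_ni].
- exact: step.
- rewrite subSn //.
  move: (n - i) => {lt_in} {}n; rewrite /loop.
  have nS : n.+1 = n %/ d * d + (n %% d).+1 by rewrite addnS -divn_eq.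
  have := steps (n %% d) (flatten (nseq (n %/ d) gamma) ++ rest).
  (* Either the turn goes on, or it closes and [top d = Z :: gamma] is reread as [top 0] above one
     more [gamma]. *)
  case: (ltngtP (n %% d).+1 d) (ltn_pmod n d_gt0) => // [lt_nd | eq_nd] _.
    have -> : n.+1 %% d = (n %% d).+1 by rewrite nS modnMDl modn_small.
    by have -> : n.+1 %/ d = n %/ d by rewrite nS divnMDl // (divn_small lt_nd) addn0.
  have -> : n.+1 %% d = 0 by rewrite nS eq_nd -mulSnr modnMl.
  have -> : n.+1 %/ d = (n %/ d).+1 by rewrite nS eq_nd -mulSnr mulnK.
  by rewrite eq_nd topd addn0 top0 rid ri /= -catA.
- rewrite eq_ni subnn /loop mod0n div0n addn0 top0 /=.
  by have := step n; rewrite eq_ni ri.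
Qed.

(** * Derived HyperLTL operators and the sentence *)

Definition And (AP : finType) (psi1 psi2 : body AP) : body AP :=
  Neg (Or (Neg psi1) (Neg psi2)).

Definition Iff (AP : finType) (psi1 psi2 : body AP) : body AP :=
  Or (And psi1 psi2) (And (Neg psi1) (Neg psi2)).

(** The grammar has no constant for truth; the tautology [Or psi (Neg psi)] replaces it. *)
Definition Eventually (AP : finType) (psi : body AP) : body AP :=
  Until (Or psi (Neg psi)) psi.

Definition Always (AP : finType) (psi : body AP) : body AP :=
  Neg (Eventually (Neg psi)).

Lemma sat_Neg (AP : finType) (Pi : assignment AP) (psi : body AP) :
  sat_body Pi (Neg psi) <-> ~ sat_body Pi psi.
Proof. by []. Qed.

Lemma sat_And (AP : finType) (Pi : assignment AP) (psi1 psi2 : body AP) :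
  sat_body Pi (And psi1 psi2) <-> sat_body Pi psi1 /\ sat_body Pi psi2.
Proof. by rewrite /=; tauto. Qed.

Lemma sat_Iff (AP : finType) (Pi : assignment AP) (psi1 psi2 : body AP) :
  sat_body Pi (Iff psi1 psi2) <-> (sat_body Pi psi1 <-> sat_body Pi psi2).
Proof. by rewrite /=; tauto. Qed.

Lemma sat_Eventually (AP : finType) (Pi : assignment AP) (psi : body AP) :
  sat_body Pi (Eventually psi) <-> exists j, sat_body (shift j Pi) psi.
Proof.
by split=> [[j []]|[j sat_j]]; exists j => //; split=> // j' _; apply: classic.
Qed.

Lemma sat_Always (AP : finType) (Pi : assignment AP) (psi : body AP) :
  sat_body Pi (Always psi) <-> forall j, sat_body (shift j Pi) psi.
Proof.
have [ev_ex ex_ev] := sat_Eventually Pi (Neg psi).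
split=> [never j | always /ev_ex[j unsat]]; last exact: unsat (always j).
by apply: NNPP => unsat; apply: never; apply: ex_ev; exists j.
Qed.

(** Variable 0 supplies the shift of [s] by one, and variable 2 turns a shift by [p] into a shift by
    [p + 1], so all positive shifts follow by induction. *)
Definition aperiodic : hyperltl bool :=
  Exists 0 (Forall 1 (Exists 2 (Body
    (And (And (Always (Iff (Atom false 0) (Next (Atom true 0))))
              (Always (Iff (Atom true 1) (Atom true 0))))
         (And (Always (Eventually (Neg (Iff (Atom true 1) (Atom false 1)))))
              (Always (Iff (Atom false 2) (Next (Atom false 1))))))))).

Lemma satisfies_aperiodic (T : trace bool -> Prop) :
  satisfies T aperiodic <->
  exists x, T x /\ forall y, T y -> exists z, T z /\
    [/\ forall n, (false \in x n) = (true \in x n.+1),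
        forall n, (true \in y n) = (true \in x n),
        forall n, exists j, (true \in y (n + j)) != (false \in y (n + j)) &
        forall n, (false \in z n) = (false \in y n.+1)].
Proof.
have iff_eq (b1 b2 : bool) : (b1 <-> b2) <-> b1 = b2.
  by split=> [/Bool.eq_iff_eq_true | ->].
rewrite /satisfies /aperiodic; cbn [sat].
split=> -[x [Tx sat_x]]; exists x; split=> // y Ty;
  have [z [Tz sat_z]] := sat_x y Ty; exists z; split=> //.
- move: sat_z => /sat_And[/sat_And[/sat_Always x_shift /sat_Always y_x]].
  case/sat_And=> /sat_Always y_diff /sat_Always z_shift.
  split=> n.
  + by have /sat_Iff/iff_eq := x_shift n; rewrite /= /suffix_trace addn0 !addn1.
  + by have /sat_Iff/iff_eq := y_x n; rewrite /= /suffix_trace addn0.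
  + have /sat_Eventually[j /sat_Neg diff_j] := y_diff n; exists j; apply/eqP => eq_y.
    by apply: diff_j; apply/sat_Iff/iff_eq; rewrite /= /suffix_trace addn0.
  + by have /sat_Iff/iff_eq := z_shift n; rewrite /= /suffix_trace addn0 !addn1.
- case: sat_z => x_shift y_x y_diff z_shift.
  apply/sat_And; split; apply/sat_And; split; apply/sat_Always => n.
  + by apply/sat_Iff/iff_eq; rewrite /= /suffix_trace addn0 !addn1.
  + by apply/sat_Iff/iff_eq; rewrite /= /suffix_trace addn0.
  + have [j /eqP diff_j] := y_diff n; apply/sat_Eventually; exists j.
    apply/sat_Neg => /sat_Iff/iff_eq eq_y; apply: diff_j; move: eq_y.
    by rewrite /= /suffix_trace addn0.
  + by apply/sat_Iff/iff_eq; rewrite /= /suffix_trace addn0 !addn1.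
Qed.

(** * A model from the powers of two *)

Definition is_pow2 (n : nat) : bool := 2 ^ trunc_log 2 n == n.

(** Since [p < 2 ^ (n + p)], adding [p] to the power [2 ^ (n + p)] stays strictly below the next
    power. *)
Lemma is_pow2_aperiodic (n p : nat) :
  0 < p -> exists j, is_pow2 (n + j) != is_pow2 (n + j + p).
Proof.
move=> p_gt0; have le_k : n + p < 2 ^ (n + p) by rewrite ltn_expl.
exists (2 ^ (n + p) - n); rewrite subnKC; last first.
  exact: leq_trans (leq_addr p n) (ltnW le_k).
rewrite /is_pow2 trunc_expnK // eqxx.
rewrite (@trunc_log_eq 2 (n + p)) //; last first.
  rewrite leq_addr expnS mul2n -addnn ltn_add2l.
  exact: leq_ltn_trans (leq_addl n p) le_k.
by rewrite -{1}[2 ^ _]addn0 eqn_add2l (ltn_eqF p_gt0).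
Qed.

Lemma satisfiable_aperiodic : satisfiable aperiodic.
Proof.
(* The shift is [p.+1] because a shift by zero would make the two components equal. *)
pose t p : trace bool := fun n =>
  [set a | if a then is_pow2 n else is_pow2 (n + p.+1)].
exists (fun u => exists p, u = t p); apply/satisfies_aperiodic.
exists (t 0); split=> [|_ [p ->]]; first by exists 0.
exists (t p.+1); split; first by exists p.+1.
split=> n; rewrite ?inE ?addn1 ?addSnnS //.
by have [j diff_j] := is_pow2_aperiodic n (ltn0Sn p); exists j; rewrite !inE.
Qed.

(** A periodic trace of [T] passes its period [P] on to the shared component [s]. The trace carrying
    [s] shifted by [P] then has equal components from [N] on, which the sentence forbids. *)
Lemma aperiodic_not_context_free (T : trace bool -> Prop) :
  omega_context_free T -> ~ satisfies T aperiodic.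
Proof.
move=> [M T_M] /satisfies_aperiodic[x [Tx sat_x]].
have [w [N [P [/T_M Tw P_gt0 w_periodic]]]] :=
  pda_accepts_periodic (proj1 (T_M x) Tx).
have shifted p : exists2 y, T y & forall n, (false \in y n) = (true \in x (n + p.+1)).
  elim: p => [|p [y Ty y_x]].
    have [_ [_ [x_shift _ _ _]]] := sat_x x Tx.
    by exists x => // n; rewrite addn1.
  have [z [Tz [_ _ _ z_y]]] := sat_x y Ty.
  by exists z => // n; rewrite z_y y_x addSnnS.
(* [shifted p] gives the shift by [p.+1], hence the predecessor. *)
have [y Ty y_x] := shifted P.-1.
have [_ [_ [_ yx y_diff _]]] := sat_x y Ty.
have [_ [_ [_ wx _ _]]] := sat_x w Tw.
have [j /eqP[]] := y_diff N.
by rewrite yx y_x prednK // -!wx w_periodic // leq_addr.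
Qed.

Theorem theorem4 :
  exists (AP : finType) (phi : hyperltl AP),
    sentence phi /\
    satisfiable phi /\
    (forall T : trace AP -> Prop, omega_context_free T -> ~ satisfies T phi).
Proof.
exists bool, aperiodic; split=> //; split; first exact: satisfiable_aperiodic.
exact: aperiodic_not_context_free.
Qed.
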